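(* Let $q\in\mathbb{C}$ be a root of unity whose order $p$ is odd, with $p\geq 3$. Let $x,y\in\mathbb{C}\setminus\{0\}$, and let $\lambda_1,\lambda_2\in\mathbb{C}$ satisfy $[\lambda_j+1-i]_q\neq 0$ for all $0\le i\le p$, $j=1,2$, and $[\lambda_1+\lambda_2-2j+1-i]_q\neq 0$ for all $0\le i\le p$, $0\le j\le p-1$. Let $\Omega_0=\frac{[\lambda_2]_q}{[\lambda_1+1]_q}\,v_0\otimes w_0\in V_{\lambda_1}(x)\otimes V_{\lambda_2}(y)$. Then the family $\{e_0^{i}f^{j}\Omega_0\mid i,j=0,1,\dots,p-1\}$ is a basis of $V_{\lambda_1}(x)\otimes V_{\lambda_2}(y)$ if and only if $$\frac{y}{x}\neq q^{-(\lambda_1+\lambda_2-2(l-1))}\quad\text{for all } l=1,2,\dots,p-1.$$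
   Context: $p$ is the smallest positive integer with $q^p=1$. A logarithm $\log q$ is fixed and $q^z=\exp(z\log q)$ for $z\in\mathbb{C}$; $[z]_q=\frac{q^z-q^{-z}}{q-q^{-1}}$. $U_q(\hat{sl_2})$ is the quantum affine algebra with generators $e_i,f_i,K_i^{\pm1}$ ($i=0,1$), and $U_q(sl_2)$ is the associative $\mathbb{C}$-algebra with generators $e,f,K^{\pm1}$ and relations $KK^{-1}=K^{-1}K=1$, $KeK^{-1}=q^2e$, $KfK^{-1}=q^{-2}f$, $[e,f]=\frac{K-K^{-1}}{q-q^{-1}}$. For $\lambda\in\mathbb{C}$, $V_\lambda$ is the $p$-dimensional $U_q(sl_2)$-module with ''normal basis'' $v_0,\dots,v_{p-1}$ and $Kv_i=q^{\lambda-2i}v_i$, $fv_i=[i+1]_qv_{i+1}$ ($i\neq p-1$), $fv_{p-1}=0$, $ev_i=[\lambda+1-i]_qv_{i-1}$ ($i\ne0$), $ev_0=0$. Write $\{v_i\}$ and $\{w_i\}$ for the normal bases of $V_{\lambda_1}$ and $V_{\lambda_2}$. The module $V_{\lambda_1}(x)\otimes V_{\lambda_2}(y)$ is the vector space $V_{\lambda_1}\otimes V_{\lambda_2}$ on which $U_q(\hat{sl_2})$ acts by $e_1\mapsto e\otimes K+1\otimes e$, $f_1\mapsto f\otimes1+K^{-1}\otimes f$, $K_1\mapsto K\otimes K$, $e_0\mapsto q^{-1}x\,f\otimes K^{-1}+q^{-1}y\,1\otimes f$, $f_0\mapsto qx^{-1}\,e\otimes1+qy^{-1}\,K\otimes e$,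 $K_0\mapsto K^{-1}\otimes K^{-1}$. In the claim $f$ acts as $f_1$, i.e. by $f\otimes1+K^{-1}\otimes f$. *)

(* Defs.v *)
From mathcomp Require Import all_boot all_order all_algebra ring.
From mathcomp Require Import complex mxtens.
From mathcomp Require Import reals sequences exp trigo.

Set Implicit Arguments.
Unset Strict Implicit.
Unset Printing Implicit Defensive.

Import Order.TTheory GRing.Theory Num.Theory.
Local Open Scope ring_scope.
Local Open Scope complex_scope.

Section QNumbers.
Variable R : realType.
Implicit Types (logq z w : R[i]).

Definition expC z : R[i] :=
  (expR (complex.Re z))%:C * (cos (complex.Im z) +i* sin (complex.Im z)).

(* The parameter q enters only through its chosen logarithm: q = expC logq. *)
Definition qpow logq z : R[i] := expC (z * logq).

Definition qnum logq z : R[i] :=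
  (qpow logq z - qpow logq (- z)) / (expC logq - (expC logq)^-1).

Lemma expC0 : expC 0 = 1.
Proof. by rewrite /expC /= expR0 cos0 sin0 mul1r. Qed.

Lemma expCD z w : expC (z + w) = expC z * expC w.
Proof.
case: z => a b; case: w => c d; rewrite /expC /= expRD cosD sinD.
by apply/eqP; rewrite eq_complex /=; apply/andP; split; apply/eqP; ring.
Qed.

Lemma qpow0 logq : qpow logq 0 = 1.
Proof. by rewrite /qpow mul0r expC0. Qed.

Lemma qpow1 logq : qpow logq 1 = expC logq.
Proof. by rewrite /qpow mul1r. Qed.

Lemma qpowD logq z w : qpow logq (z + w) = qpow logq z * qpow logq w.
Proof. by rewrite /qpow mulrDl expCD. Qed.

Lemma qpowNK logq z : qpow logq (- z) * qpow logq z = 1.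
Proof. by rewrite -qpowD addNr qpow0. Qed.

Lemma qpow_neq0 logq z : qpow logq z != 0.
Proof.
by apply/eqP => h; have /eqP := qpowNK logq z; rewrite h mulr0 eq_sym oner_eq0.
Qed.

Lemma qpowN logq z : qpow logq (- z) = (qpow logq z)^-1.
Proof.
by apply: (mulIf (qpow_neq0 logq z)); rewrite qpowNK mulVf ?qpow_neq0.
Qed.

Lemma qpow_nat logq n : qpow logq n%:R = expC logq ^+ n.
Proof.
elim: n => [|n IHn]; first by rewrite qpow0.
by rewrite -addn1 natrD qpowD qpow1 IHn addn1 exprSr.
Qed.

End QNumbers.

Section Vlambda.
Variables (R : realType) (logq : R[i]) (p : nat).
Implicit Types (lambda : R[i]).

(* Operators act on column vectors from the left: column i of a matrix is the
   image of the i-th normal basis vector. *)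
Definition normal_basis (i : nat) : 'cV[R[i]]_p := \col_(k < p) (val k == i)%:R.

Definition Vf : 'M[R[i]]_p :=
  \matrix_(k < p, i < p) (qnum logq (i.+1)%:R *+ (val k == i.+1)).

Definition Ve lambda : 'M[R[i]]_p :=
  \matrix_(k < p, i < p) (qnum logq (lambda + 1 - i%:R) *+ (k.+1 == val i)).

Definition VK lambda : 'M[R[i]]_p :=
  diag_mx (\row_(i < p) qpow logq (lambda - (2 * i)%:R)).

Lemma Vf_basis (i : nat) : (i < p)%N ->
  Vf *m normal_basis i = qnum logq (i.+1)%:R *: normal_basis i.+1.
Proof.
move=> lt_ip; apply/matrixP=> k j; rewrite !mxE (bigD1 (Ordinal lt_ip)) //=.
rewrite !mxE /= eqxx mulr1 big1 => [|l]; first by rewrite addr0 mulr_natr.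
by rewrite -val_eqE !mxE /= => /negbTE->; rewrite mulr0.
Qed.

Lemma normal_basis_p : normal_basis p = 0.
Proof. by apply/matrixP=> k j; rewrite !mxE ltn_eqF ?ltn_ord. Qed.

Lemma Ve_basis0 lambda : Ve lambda *m normal_basis 0 = 0.
Proof.
apply/matrixP=> k j; rewrite !mxE big1 // => l _; rewrite !mxE.
by case: l => [[|n] ?] /=; rewrite ?mulr0n ?mul0r ?mulr0.
Qed.

Lemma Ve_basis lambda (i : nat) : (i.+1 < p)%N ->
  Ve lambda *m normal_basis i.+1 =
  qnum logq (lambda + 1 - (i.+1)%:R) *: normal_basis i.
Proof.
move=> lt_ip; apply/matrixP=> k j; rewrite !mxE (bigD1 (Ordinal lt_ip)) //=.
rewrite !mxE /= eqxx mulr1 big1 => [|l]; first by rewrite addr0 eqSS mulr_natr.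
by rewrite -val_eqE !mxE /= => /negbTE->; rewrite mulr0.
Qed.

Lemma VK_basis lambda (i : nat) :
  VK lambda *m normal_basis i = qpow logq (lambda - (2 * i)%:R) *: normal_basis i.
Proof.
apply/matrixP=> k j; rewrite mul_diag_mx !mxE.
by case: eqP => [->|_] //; rewrite !mulr0.
Qed.

Lemma VK_unit lambda : VK lambda \in unitmx.
Proof.
rewrite unitmxE det_diag unitfE; apply/prodf_neq0 => i _.
by rewrite mxE qpow_neq0.
Qed.

Lemma invmx_VK lambda :
  invmx (VK lambda) = diag_mx (\row_(i < p) qpow logq ((2 * i)%:R - lambda)).
Proof.
apply: (can_inj (mulKmx (VK_unit lambda))); rewrite mulmxV ?VK_unit //.
rewrite /VK mulmx_diag -[1%:M]diag_const_mx; congr diag_mx.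
apply/rowP=> i; rewrite !mxE -qpowD.
by rewrite [X in qpow _ X](_ : _ = 0) ?qpow0 //; ring.
Qed.

End Vlambda.

Section UqslTwo.
Variables (R : realType) (logq : R[i]).
Local Notation q := (expC logq).

Definition Uq_sl2_relations n (e f K : 'M[R[i]]_n) : Prop :=
  [/\ K \in unitmx,
      K *m e *m invmx K = q ^+ 2 *: e,
      K *m f *m invmx K = q ^- 2 *: f &
      e *m f - f *m e = (q - q^-1)^-1 *: (K - invmx K)].

Lemma Vlambda_module (p : nat) (lambda : R[i]) :
    q ^+ p = 1 -> q != q^-1 ->
  Uq_sl2_relations (Ve logq p lambda) (Vf logq p) (VK logq p lambda).
Proof.
move=> qp1 q2n1; have q0 : q != 0 by rewrite -qpow1 qpow_neq0.
have dq0 : q - q^-1 != 0 by rewrite subr_eq0.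
have qq0 : q * q - 1 != 0.
  apply: contra dq0 => /eqP h.
  have -> : q - q^-1 = (q * q - 1) / q by rewrite mulrBl mulfK ?mul1r.
  by rewrite h mul0r.
split; first exact: VK_unit.
- rewrite invmx_VK; apply/matrixP=> k i.
  rewrite mul_diag_mx mul_mx_diag !mxE.
  case: eqP => [<-|_]; last by rewrite !mulr0n !(mulr0, mul0r).
  rewrite !mulr1n mulrAC -qpowD -qpow_nat; congr (qpow _ _ * _).
  by rewrite !natrM -(addn1 k) natrD; ring.
- rewrite invmx_VK; apply/matrixP=> k i.
  rewrite mul_diag_mx mul_mx_diag !mxE.
  case: eqP => [->|_]; last by rewrite !mulr0n !(mulr0, mul0r).
  rewrite !mulr1n mulrAC -qpowD -qpow_nat -qpowN; congr (qpow _ _ * _).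
  by rewrite !natrM -(addn1 i) natrD; ring.
suff step (i : nat) : (i < p)%N ->
    (Ve logq p lambda *m Vf logq p - Vf logq p *m Ve logq p lambda)
      *m normal_basis R p i =
    ((q - q^-1)^-1 *: (VK logq p lambda - invmx (VK logq p lambda)))
      *m normal_basis R p i.
  apply/matrixP=> k i; have /matrixP/(_ k 0) := step i (ltn_ord i).
  have colE (A : 'M[R[i]]_p) : (A *m normal_basis R p i) k 0 = A k i.
    rewrite mxE (bigD1 i) //= mxE eqxx mulr1 big1 ?addr0 // => l.
    by rewrite -val_eqE !mxE /= => /negbTE->; rewrite mulr0.
  by rewrite !colE.
move=> lt_ip.
have ef : Ve logq p lambda *m (Vf logq p *m normal_basis R p i) =
    (qnum logq (i.+1)%:R * qnum logq (lambda + 1 - (i.+1)%:R))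
      *: normal_basis R p i.
  rewrite Vf_basis // -scalemxAr.
  move: (lt_ip); rewrite leq_eqVlt => /orP[/eqP ip|lt_i1p].
    rewrite {2}ip normal_basis_p mulmx0 scaler0 ip.
    by rewrite /qnum qpowN qpow_nat qp1 invr1 subrr !mul0r scale0r.
  by rewrite Ve_basis // scalerA.
have fe : Vf logq p *m (Ve logq p lambda *m normal_basis R p i) =
    (qnum logq (lambda + 1 - i%:R) * qnum logq i%:R) *: normal_basis R p i.
  case: i lt_ip {ef} => [|i] lt_ip.
    by rewrite Ve_basis0 mulmx0 /qnum oppr0 subrr mul0r mulr0 scale0r.
  by rewrite Ve_basis // -scalemxAr Vf_basis ?(ltnW lt_ip) // scalerA.
have Ki : invmx (VK logq p lambda) *m normal_basis R p i =
    qpow logq (- (lambda - (2 * i)%:R)) *: normal_basis R p i.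
  apply: (can_inj (mulKmx (VK_unit logq p lambda))).
  by rewrite mulKVmx ?VK_unit // -scalemxAr VK_basis scalerA qpowNK scale1r.
rewrite mulmxBl -!mulmxA ef fe -scalemxAl mulmxBl VK_basis Ki.
rewrite -!scalerBl scalerA; congr (_ *: _).
rewrite /qnum -(addn1 i) natrM natrD !(qpowD, qpowN) mulr_natl mulr2n.
rewrite !(qpowD, qpowN) qpow1.
have := qpow_neq0 logq lambda; have := qpow_neq0 logq i%:R.
by move=> hi hl; field; rewrite ?q0 ?hi ?hl ?qq0 /=.
Qed.

End UqslTwo.

Section AffineAction.
Variables (R : realType) (logq : R[i]) (p : nat).
Variables (lambda1 lambda2 x y : R[i]).
Local Notation q := (expC logq).

Variant Uq_affine_gen := Ge0 | Ge1 | Gf0 | Gf1 | GK0 | GK1.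

(* Action of the generators of U_q(\hat{sl_2}) on
   V_lambda1(x) \otimes V_lambda2(y); *t is the Kronecker product. *)
Definition eval_tensor_act (g : Uq_affine_gen) : 'M[R[i]]_(p * p) :=
  let e1 := Ve logq p lambda1 in let e2 := Ve logq p lambda2 in
  let f1 := Vf logq p in let f2 := Vf logq p in
  let K1 := VK logq p lambda1 in let K2 := VK logq p lambda2 in
  let id : 'M[R[i]]_p := 1%:M in
  match g with
  | Ge1 => e1 *t K2 + id *t e2
  | Gf1 => f1 *t id + invmx K1 *t f2
  | GK1 => K1 *t K2
  | Ge0 => (q^-1 * x) *: (f1 *t invmx K2) + (q^-1 * y) *: (id *t f2)
  | Gf0 => (q * x^-1) *: (e1 *t id) + (q * y^-1) *: (K1 *t e2)
  | GK0 => invmx K1 *t invmx K2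
  end.

Definition Omega0 : 'cV[R[i]]_(p * p) :=
  (qnum logq lambda2 / qnum logq (lambda1 + 1)) *:
    ((normal_basis R p 0 *t normal_basis R p 0) : 'cV[R[i]]_(p * p)).

End AffineAction.

(* Main.v *)
From HB Require Import structures.
Require Import Defs.
From mathcomp Require Import all_boot all_order all_algebra ring zify.
From mathcomp Require Import complex mxtens.
From mathcomp Require Import reals sequences exp trigo.

Set Implicit Arguments.
Unset Strict Implicit.
Unset Printing Implicit Defensive.

Import Order.TTheory GRing.Theory Num.Theory.
Local Open Scope ring_scope.
Local Open Scope complex_scope.

(** Both e_0 and f raise the degree a + b of v_a (x) w_b by one, so the
question splits into one linear algebra problem for each degree d.  Put
Q = q^2, alpha = q^(-lambda1), beta = x q^(-lambda2), and let
u_{a,b} = [a]! [b]! v_a (x) w_b.  Then f and q e_0 act by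
<<
   f     : u_{a,b} |-> u_{a+1,b} + alpha Q^a u_{a,b+1}
   q e_0 : u_{a,b} |-> beta Q^b u_{a+1,b} + y u_{a,b+1}.
>>
Encode a degree d vector by a polynomial g of degree at most d, the monomial
X^a standing for Q^(-a(a-1)/2) u_{a,d-a} ([poly_vec]).  With this weight f
becomes g(X) |-> (X + alpha) g(Q X), and q e_0, although it also involves a
Q-shift, becomes multiplication by the linear form beta Q^d X + y
([F_poly_vec], [E_poly_vec]).  Hence, up to a nonzero scalar,
e_0^i f^j Omega0 is the fully factored polynomial
<<
   prod_(j <= m < i + j) (beta Q^m X + y) * prod_(k < j) (Q^k X + alpha).
>>
The second product vanishes at the points r_k = - alpha Q^(-k), k < j, and the
first one takes at r_j the value prod_(m < i) (y - alpha beta Q^m).  So in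
each degree the polynomials form a triangular system for Newton interpolation
at r_0, r_1, r_2, ..., and what matters is whether y = alpha beta Q^m; the
excluded values of y / x are exactly these, with m = l - 1 ([resonance]).

If y = alpha beta Q^(l-1) with 0 < l < p, then in degree l all the polynomials
vanish at r_0 = - alpha, so evaluation at r_0 is a nonzero functional that
kills the whole family ([functional_word_eq0]).

Otherwise the family spans, and hence is a basis as it has p^2 elements.  For
d < p this is Newton interpolation ([newton_expansion]).  For d >= p the vector
u_{a,d-a} vanishes unless d - p < a < p.  Then the missing Newton polynomials,
those with j <= d - p, may be taken of degree j and encode the zero vector,
while the remainder after p steps is a multiple of
prod_(k < p) (X - r_k) = X^p + alpha^p and encodes zero as well
([poly_vec_full_orbit]). *)

(** * Polynomials and interpolation *)

Lemma span_scalar_eq0 (K : fieldType) (V : vectType K) (phi : {scalar V})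
    (X : seq V) v :
  {in X, forall w, phi w = 0} -> v \in <<X>>%VS -> phi v = 0.
Proof.
move=> phiX /(@coord_span _ _ _ (in_tuple X))->; rewrite linear_sum.
by rewrite big1 // => i _; rewrite linearZ /= phiX ?mulr0 // mem_nth.
Qed.

Section Polynomials.
Variable K : fieldType.
Implicit Types (g h : {poly K}) (Q c : K).

Lemma coef_comp_scaleX g Q a : (g \Po (Q *: 'X))`_a = g`_a * Q ^+ a.
Proof.
rewrite coef_comp_poly; under eq_bigr do rewrite exprZn coefZ coefXn.
case: (ltnP a (size g)) => [lt_ag|le_ga].
  rewrite (bigD1 (Ordinal lt_ag)) //= eqxx mulr1 big1 ?addr0 // => i.
  by rewrite -val_eqE /= eq_sym => /negbTE->; rewrite !mulr0.
rewrite nth_default // mul0r big1 // => i _.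
by rewrite gtn_eqF ?mulr0 // (leq_trans (ltn_ord i)).
Qed.

(** Newton interpolation by synthetic division: the remainder after [n] steps
is corrected by the multiple of [T n] that makes it vanish at [r n], and then
['X - r n] is divided out.  The points [r k] may be repeated. *)
Lemma newton_expansion (r : nat -> K) (T : nat -> {poly K}) n g :
    (forall j, (j < n)%N -> (T j).[r j] != 0) ->
  exists c : nat -> K, exists h, g =
    \sum_(j < n) c j *: ((\prod_(k < j) ('X - (r k)%:P)) * T j)
      + h * \prod_(k < n) ('X - (r k)%:P).
Proof.
elim: n => [|n IHn] T_neq0.
  by exists (fun=> 0), g; rewrite !big_ord0 add0r mulr1.
have [j lt_jn|c [h ->]] := IHn; first exact/T_neq0/ltnW.
set b := h.[r n] / (T n).[r n].
have /factor_theorem[h' Dh'] : root (h - b *: T n) (r n).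
  by rewrite /root !hornerE divfK ?subrr // T_neq0.
clearbody b; exists (fun j => if j == n then b else c j), h'.
rewrite big_ord_recr /= eqxx -addrA; congr (_ + _).
  by apply: eq_bigr => j _; rewrite ltn_eqF.
have -> : h = h' * ('X - (r n)%:P) + b *: T n by rewrite -Dh' subrK.
by rewrite big_ord_recr /= -!mul_polyC; ring.
Qed.

Lemma prod_XsubC_geom n Q c : n.-primitive_root Q -> c != 0 ->
  \prod_(k < n) ('X - (c / Q ^+ k)%:P) = 'X^n - (c ^+ n)%:P.
Proof.
move=> prQ c0; have n_gt0 := prim_order_gt0 prQ.
have Q0 : Q != 0.
  apply: contraTneq (oner_neq0 K) => Q0; have := prim_expr_order prQ.
  by rewrite Q0 expr0n gtn_eqF // => <-; rewrite eqxx.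
have size_p : size ('X^n - (c ^+ n)%:P) = n.+1 by rewrite size_XnsubC.
pose rs := [seq c / Q ^+ k | k <- index_iota 0 n].
rewrite [RHS](@all_roots_prod_XsubC _ _ rs).
- rewrite lead_coefDl ?size_polyXn; last first.
    by rewrite size_polyN size_polyC; case: (n) n_gt0 => // m; case: (_ != 0).
  by rewrite lead_coefXn scale1r big_map big_mkord.
- by rewrite size_p size_map size_iota subn0.
- apply/allP=> _ /mapP[k _ ->]; rewrite /root !hornerE expr_div_n.
  by rewrite -exprM mulnC exprM (prim_expr_order prQ) expr1n divr1 subrr.
- rewrite uniq_rootsE map_inj_in_uniq ?iota_uniq // => i j.
  rewrite !mem_index_iota /= => lt_in lt_jn /(mulfI c0)/invr_inj/eqP.
  by rewrite (eq_prim_root_expr prQ) !modn_small // => /eqP.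
Qed.

End Polynomials.

(** * Two raising operators on a quantum plane *)

Section QuantumPlane.
Variables (K : fieldType) (V : vectType K) (u : nat -> nat -> V).
Variables (F E : {linear V -> V}) (Q al be y : K).
Implicit Types g h : {poly K}.
Hypothesis Q_neq0 : Q != 0.
Hypothesis F_u : forall a b, F (u a b) = u a.+1 b + (al * Q ^+ a) *: u a b.+1.
Hypothesis E_u : forall a b,
  E (u a b) = (be * Q ^+ b) *: u a.+1 b + y *: u a b.+1.

(** The weight [Q ^+ 'C(a, 2)] is what turns [F] and [E] into multiplications
by linear forms, up to the substitution of [Q *: 'X]: it absorbs the factor
[Q ^+ a] gained by either operator when [a] increases. *)
Definition poly_vec d (g : {poly K}) : V :=
  \sum_(a < d.+1) (g`_a / Q ^+ 'C(a, 2)) *: u a (d - a).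

Lemma poly_vec_linear d : linear (poly_vec d).
Proof.
move=> c g h; rewrite /poly_vec scaler_sumr -big_split; apply: eq_bigr => a _.
by rewrite /= coefD coefZ mulrDl scalerDl scalerA mulrA.
Qed.

HB.instance Definition _ d :=
  GRing.isLinear.Build K {poly K} V _ (poly_vec d) (poly_vec_linear d).

Lemma poly_vecXn a b : poly_vec (a + b) 'X^a = (Q ^+ 'C(a, 2))^-1 *: u a b.
Proof.
have lt_a : (a < (a + b).+1)%N by lia.
rewrite /poly_vec (bigD1 (Ordinal lt_a)) //= coefXn eqxx mul1r addKn.
rewrite big1 ?addr0 // => i; rewrite -val_eqE /= => /negbTE ni.
by rewrite coefXn ni mul0r scale0r.
Qed.

Lemma F_poly_vec d g : (size g <= d.+1)%N ->
  F (poly_vec d g) = poly_vec d.+1 (('X + al%:P) * (g \Po (Q *: 'X))).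
Proof.
move=> le_gd; rewrite linear_sum /=.
under eq_bigr do rewrite linearZ /= F_u scalerDr.
rewrite big_split /= mulrDl linearD /=; congr (_ + _).
  rewrite /poly_vec [RHS]big_ord_recl coefXM /= mul0r scale0r add0r.
  apply: eq_bigr => a _.
  rewrite /bump leq0n add1n coefXM /= coef_comp_scaleX subSS binS bin1.
  by rewrite exprD -mulf_div divff ?mulr1 // expf_neq0.
rewrite /poly_vec [RHS]big_ord_recr /= coefCM coef_comp_scaleX.
rewrite (nth_default _ le_gd) !(mulr0, mul0r) scale0r addr0.
apply: eq_bigr => a _; rewrite scalerA coefCM coef_comp_scaleX.
rewrite subSn; last by rewrite -ltnS.
by congr (_ *: _); ring.
Qed.

(** The coefficient [be * Q ^+ (d - a)] depends on [a], but the quotient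
[Q ^+ a] of two consecutive weights compensates for it. *)
Lemma E_poly_vec d g : (size g <= d.+1)%N ->
  E (poly_vec d g) = poly_vec d.+1 (((be * Q ^+ d) *: 'X + y%:P) * g).
Proof.
move=> le_gd; rewrite linear_sum /=.
under eq_bigr do rewrite linearZ /= E_u scalerDr.
rewrite big_split /= mulrDl linearD /=; congr (_ + _).
  rewrite /poly_vec [RHS]big_ord_recl -scalerAl coefZ coefXM /= mulr0 mul0r.
  rewrite scale0r add0r; apply: eq_bigr => a _.
  rewrite /bump leq0n add1n coefZ coefXM /= subSS scalerA; congr (_ *: _).
  have -> : Q ^+ d = Q ^+ (d - a) * Q ^+ a by rewrite -exprD subnK // -ltnS.
  rewrite binS bin1 exprD.
  have := expf_neq0 a Q_neq0; have := expf_neq0 'C(a, 2) Q_neq0.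
  move: (Q ^+ a) (Q ^+ 'C(a, 2)) (Q ^+ (d - a)) => z1 z2 z3 h1 h2.
  by field; rewrite h1 h2.
rewrite /poly_vec [RHS]big_ord_recr /= coefCM.
rewrite (nth_default _ le_gd) !(mulr0, mul0r) scale0r addr0.
apply: eq_bigr => a _; rewrite scalerA coefCM.
rewrite subSn; last by rewrite -ltnS.
by congr (_ *: _); ring.
Qed.

Definition F_factor (j : nat) : {poly K} :=
  \prod_(k < j) (Q ^+ k *: 'X + al%:P).

(** The index [m] starts at [j] because multiplication by the linear form of
[E] depends on the degree, which is already [j] after [j] applications of
[F]. *)
Definition E_factor (i j : nat) : {poly K} :=
  \prod_(m < i) ((be * Q ^+ (j + m)) *: 'X + y%:P).

Lemma size_linear_factor (c b : K) : (size (c *: 'X + b%:P)%R <= 2)%N.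
Proof.
rewrite (leq_trans (size_polyD _ _)) // geq_max size_polyC.
by rewrite (leq_trans (size_scale_leq _ _)) ?size_polyX //; case: (b != 0).
Qed.

Lemma size_linear_prod n (c b : nat -> K) :
  (size (\prod_(k < n) (c k *: 'X + (b k)%:P))%R <= n.+1)%N.
Proof.
elim: n => [|n IHn]; first by rewrite big_ord0 size_polyC oner_neq0.
rewrite big_ord_recr /= (leq_trans (size_polyMleq _ _)) // -subn1 leq_subLR.
by rewrite (leq_trans (leq_add IHn (size_linear_factor _ _))) // addn2.
Qed.

Lemma size_F_factor j : (size (F_factor j) <= j.+1)%N.
Proof. exact: (size_linear_prod _ _ (fun=> al)). Qed.

Lemma size_E_factor i j : (size (E_factor i j) <= i.+1)%N.
Proof. exact: (size_linear_prod _ (fun m => be * Q ^+ (j + m)) (fun=> y)). Qed.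

Lemma size_word i j : (size (E_factor i j * F_factor j)%R <= (i + j).+1)%N.
Proof.
rewrite (leq_trans (size_polyMleq _ _)) //.
have := size_E_factor i j; have := size_F_factor j; lia.
Qed.

Lemma word_poly_vec i j :
  iter i E (iter j F (u 0 0)) = poly_vec (i + j) (E_factor i j * F_factor j).
Proof.
elim: i => [|i IHi] /=.
  rewrite add0n /E_factor big_ord0 mul1r.
  elim: j => [|j IHj] /=.
    rewrite /F_factor big_ord0 -(expr0 'X).
    by have := poly_vecXn 0 0; rewrite bin0n invr1 scale1r => ->.
  rewrite IHj F_poly_vec ?size_F_factor //; congr poly_vec.
  rewrite /F_factor big_ord_recl expr0 scale1r; congr (_ * _).
  rewrite rmorph_prod; apply: eq_bigr => k _.
  rewrite lift0 /= comp_polyD comp_polyC comp_polyZ comp_polyX scalerA.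
  by rewrite -exprSr.
rewrite IHi E_poly_vec ?size_word // addSn; congr poly_vec.
rewrite /E_factor [in RHS]big_ord_recr /= addnC mulrA.
by rewrite [_ * \prod_(m < i) _]mulrC.
Qed.

Lemma F_factor_roots j : F_factor j =
  Q ^+ 'C(j, 2) *: \prod_(k < j) ('X - (- al / Q ^+ k)%:P).
Proof.
rewrite /F_factor; elim: j => [|j IHj]; first by rewrite !big_ord0 scale1r.
rewrite !big_ord_recr /= IHj binS bin1 exprD.
have -> : Q ^+ j *: 'X + al%:P = Q ^+ j *: ('X - (- al / Q ^+ j)%:P).
  rewrite scalerBr -[_ *: _%:P]mul_polyC -polyCM mulrC divfK ?expf_neq0 //.
  by rewrite polyCN opprK.
by rewrite -scalerAl -scalerAr scalerA.
Qed.

Lemma E_factor_neq0 i j :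
    (forall r, (r < i)%N -> y != al * be * Q ^+ r) ->
  (E_factor i j).[- al / Q ^+ j] != 0.
Proof.
move=> y_neq; rewrite horner_prod; apply/prodf_neq0 => m _.
rewrite !hornerE exprD; apply: contra (y_neq m (ltn_ord m)) => /eqP h.
have Qj := expf_neq0 j Q_neq0; rewrite -subr_eq0 -h; apply/eqP.
by move: (Q ^+ j) (Q ^+ m) Qj => /= z1 z2 z10; field.
Qed.

(** Such a [phi] reads off the degree [d] part of a vector and evaluates its
polynomial at [- al].  This is a root of [F_factor j] for [j > 0], and in the
remaining word [E ^ d] it is a root of the factor of index [r]. *)
Lemma functional_word_eq0 (phi : {scalar V}) d r i j :
    (forall a b,
       phi (u a b) =
         if (a + b == d)%N then Q ^+ 'C(a, 2) * (- al) ^+ a else 0) ->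
    (r < d)%N -> y = al * be * Q ^+ r ->
  phi (iter i E (iter j F (u 0 0))) = 0.
Proof.
move=> phi_u lt_rd Dy; rewrite word_poly_vec.
have phiE g : (size g <= d.+1)%N -> phi (poly_vec d g) = g.[- al].
  move=> le_gd; rewrite (horner_coef_wide _ le_gd) linear_sum.
  apply: eq_bigr => a _.
  rewrite linearZ /= phi_u subnKC ?eqxx -1?ltnS // mulrA divfK //.
  exact: expf_neq0.
have [Dd|ne_d] := eqVneq (i + j)%N d; last first.
  rewrite linear_sum big1 // => a _; rewrite linearZ /= phi_u subnKC -1?ltnS //.
  by rewrite (negbTE ne_d) mulr0.
have sz := size_word i j; rewrite Dd in sz *.
rewrite phiE // hornerM; case: j Dd {sz} => [|j] Dd; last first.
  by rewrite /F_factor horner_prod big_ord_recl !hornerE /= addNr mulr0 mul0r.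
rewrite addn0 in Dd; rewrite Dd /E_factor horner_prod.
rewrite (bigD1 (Ordinal lt_rd)) //=.
by rewrite !hornerE Dy (_ : _ + _ = 0) ?mul0r //=; ring.
Qed.

Section Nilpotent.
Variable p : nat.
Hypothesis Q_prim : p.-primitive_root Q.
Hypothesis al_neq0 : al != 0.
Hypothesis u_eq0 : forall a b, (p <= a)%N || (p <= b)%N -> u a b = 0.

Lemma poly_vec_eq0 d g :
  (forall a, (a < p)%N -> (d < a + p)%N -> g`_a = 0) -> poly_vec d g = 0.
Proof.
move=> g0; rewrite /poly_vec big1 // => a _.
have [h|h] := boolP ((p <= a) || (p <= d - a))%N.
  by rewrite u_eq0 ?scaler0.
rewrite g0 ?mul0r ?scale0r //; have := ltn_ord a; lia.
Qed.

(** The product is ['X^p - (- al) ^+ p], so the bound on [size h] leaves only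
exponents [a] with [p <= a] or [p <= d - a]. *)
Lemma poly_vec_full_orbit d h : (size h + p <= d.+1)%N ->
  poly_vec d (h * \prod_(k < p) ('X - (- al / Q ^+ k)%:P)) = 0.
Proof.
move=> le_hd; rewrite (prod_XsubC_geom Q_prim) ?oppr_eq0 //.
apply: poly_vec_eq0 => a lt_ap lt_da; rewrite mulrBr coefB coefMXn lt_ap.
by rewrite coefMC (nth_default _ (_ : (size h <= a)%N)) ?mul0r ?subr0 //; lia.
Qed.

(** Interpolate [g] at the roots of the factors of [F].  In degree [d] the words
available are [E ^ (d - j) F ^ j] with [d - p < j < p]; they supply the Newton
polynomials of these indices. *)
Lemma poly_vec_span (S : {vspace V}) d g :
    (forall r, (r.+1 < p)%N -> y != al * be * Q ^+ r) ->
    (forall i j, (i < p)%N -> (j < p)%N -> iter i E (iter j F (u 0 0)) \in S) ->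
  (size g <= d.+1)%N -> poly_vec d g \in S.
Proof.
move=> y_neq S_word le_gd.
(* For j + p <= d the word would need at least p applications of E; the Newton
   polynomial of degree j with cofactor 1 encodes the zero vector instead. *)
pose T j : {poly K} := if (j + p <= d)%N then 1 else E_factor (d - j) j.
(* No interpolation point is left beyond degree d, and after p points the
   remainder already encodes zero. *)
have [n Dn] : exists n, n = minn d.+1 p by exists (minn d.+1 p).
have [j lt_jn|c [h Dg]] := @newton_expansion _ (fun k => - al / Q ^+ k) T n g.
  rewrite /T; case: ifP => [_|njd]; first by rewrite hornerE oner_neq0.
  by apply: E_factor_neq0 => r lt_r; apply: y_neq; lia.
pose B j := (\prod_(k < j) ('X - (- al / Q ^+ k)%:P)) * T j.
have szP m : size (\prod_(k < m) ('X - (- al / Q ^+ k)%:P)) = m.+1.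
  by rewrite size_prod_XsubC [index_enum _]unlock -enumT -cardT card_ord.
have szB (j : 'I_n) : (size (B j) <= d.+1)%N.
  rewrite (leq_trans (size_polyMleq _ _)) // szP /T.
  have lt_jn := ltn_ord j; case: ifP => [le_jd|_].
    by rewrite size_poly1; lia.
  by have := size_E_factor (d - j) j; move: (size _) => s; lia.
have vB (j : 'I_n) : poly_vec d (B j) \in S.
  have lt_jn : (j < d.+1)%N && (j < p)%N by have := ltn_ord j; lia.
  have [le_jd|lt_dj] := leqP (j + p) d.
    rewrite poly_vec_eq0 ?mem0v // => a lt_ap lt_da.
    by rewrite /B /T le_jd mulr1 nth_default // szP; lia.
  rewrite /B /T leqNgt lt_dj /=.
  have := S_word (d - j)%N j; rewrite word_poly_vec subnK; last by lia.
  rewrite F_factor_roots -scalerAr linearZ /= mulrC rpredZeq expf_eq0.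
  by rewrite (negbTE Q_neq0) andbF; apply; lia.
rewrite Dg linearD linear_sum /= memvD //.
  by apply: memv_suml => j _; rewrite linearZ memvZ //= vB.
have le_h : (size (h * \prod_(k < n) ('X - (- al / Q ^+ k)%:P))%R <= d.+1)%N.
  rewrite (_ : h * _ = g - \sum_(j < n) c j *: B j); last first.
    by rewrite [g]Dg addrC addKr.
  rewrite (leq_trans (size_polyD _ _)) // geq_max le_gd size_polyN.
  rewrite (leq_trans (size_sum _ _ _)) //; apply/bigmax_leqP => j _.
  exact: leq_trans (size_scale_leq _ _) (szB j).
have [->|h_neq0] := eqVneq h 0; first by rewrite mul0r linear0 mem0v.
have h_gt0 : (0 < size h)%N by rewrite size_poly_gt0.
have orbit0 := @poly_vec_full_orbit d h.
move: le_h; rewrite mulrC size_monicM ?monic_prod_XsubC // szP addSn /=.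
move: h_gt0 orbit0; move: (size h) => s s_gt0 orbit0 le_s.
have -> : n = p by lia.
by rewrite mulrC orbit0 ?mem0v //; lia.
Qed.

Lemma word_span (S : {vspace V}) a b :
    (forall r, (r.+1 < p)%N -> y != al * be * Q ^+ r) ->
    (forall i j, (i < p)%N -> (j < p)%N -> iter i E (iter j F (u 0 0)) \in S) ->
  u a b \in S.
Proof.
move=> y_neq S_word.
have : poly_vec (a + b) 'X^a \in S.
  by apply: poly_vec_span => //; rewrite size_polyXn ltnS leq_addr.
by rewrite poly_vecXn rpredZeq invr_eq0 expf_eq0 (negbTE Q_neq0) andbF.
Qed.

End Nilpotent.
End QuantumPlane.

(** * The tensor product of evaluation modules *)

Section EvaluationTensor.
Variables (R : realType) (logq : R[i]) (p : nat).
Variables (lambda1 lambda2 x y : R[i]).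
Hypothesis p_odd : odd p.
Hypothesis p_ge3 : (3 <= p)%N.
Local Notation q := (expC logq).
Hypothesis q_prim : p.-primitive_root q.
Local Notation Q := (q ^+ 2).
Local Notation al := (qpow logq (- lambda1)).
Local Notation be := (x * qpow logq (- lambda2)).
Local Notation nb := (normal_basis R p).
Local Notation act := (eval_tensor_act logq p lambda1 lambda2 x y).

Lemma q2_prim : p.-primitive_root Q.
Proof. by rewrite prim_root_exp_coprime // coprime2n. Qed.

Lemma q_neq0 : q != 0.
Proof. by rewrite -qpow1 qpow_neq0. Qed.

Lemma qnum_nat_neq0 n : (0 < n < p)%N -> qnum logq n%:R != 0.
Proof.
move=> /andP[n_gt0 lt_np].
have q2n k : (0 < k < p)%N -> q ^+ k - (q ^+ k)^-1 != 0.
  move=> /andP[k_gt0 lt_kp]; rewrite subr_eq0; apply/eqP => qk.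
  have /eqP : Q ^+ k = Q ^+ 0.
    by rewrite expr0 exprAC expr2 {1}qk mulVf // expf_neq0 ?q_neq0.
  by rewrite (eq_prim_root_expr q2_prim) mod0n modn_small // gtn_eqF.
rewrite /qnum qpowN qpow_nat mulf_neq0 ?invr_neq0 ?q2n ?n_gt0 //.
by rewrite -[q]expr1 q2n //= (leq_trans _ p_ge3).
Qed.

Lemma normal_basis_eq0 i : (p <= i)%N -> nb i = 0.
Proof.
move=> le_pi; apply/matrixP => k j.
by rewrite !mxE ltn_eqF // (leq_trans (ltn_ord k)).
Qed.

Lemma Vf_normal_basis i : Vf logq p *m nb i = qnum logq i.+1%:R *: nb i.+1.
Proof.
have [lt_ip|le_pi] := ltnP i p; first exact: Vf_basis.
by rewrite !normal_basis_eq0 ?mulmx0 ?scaler0 // leqW.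
Qed.

Lemma invVK_normal_basis lambda i :
  invmx (VK logq p lambda) *m nb i = (qpow logq (- lambda) * Q ^+ i) *: nb i.
Proof.
rewrite invmx_VK; apply/matrixP => k j; rewrite mul_diag_mx !mxE.
case: eqP => [->|_]; last by rewrite !mulr0.
by rewrite addrC qpowD qpow_nat exprM.
Qed.

(** The Kronecker product of two columns has [1 * 1] columns; fixing its type
as a column vector lets it be rewritten uniformly with matrix products. *)
Definition pure (v w : 'cV[R[i]]_p) : 'cV[R[i]]_(p * p) := v *t w.

Lemma pureZ c e v w : pure (c *: v) (e *: w) = (c * e) *: pure v w.
Proof. by apply/matrixP => k j; rewrite !mxE mulrACA. Qed.

Lemma tensmx_pure (A B : 'M_p) v w :
  (A *t B) *m pure v w = pure (A *m v) (B *m w).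
Proof. exact: (tensmx_mul A B v w). Qed.

Definition qfact n : R[i] := \prod_(k < n) qnum logq k.+1%:R.

Lemma qfactS n : qfact n.+1 = qnum logq n.+1%:R * qfact n.
Proof. by rewrite /qfact big_ord_recr mulrC. Qed.

Lemma qfact_neq0 n : (n < p)%N -> qfact n != 0.
Proof.
move=> lt_np; apply/prodf_neq0 => k _; apply: qnum_nat_neq0 => /=.
by rewrite (leq_ltn_trans (ltn_ord k)).
Qed.

(** The vector f^a v_0 (x) f^b w_0: the q-factorials turn the normal basis into
iterated images of the highest weight vectors. *)
Definition monomial a b : 'cV[R[i]]_(p * p) :=
  (qfact a * qfact b) *: pure (nb a) (nb b).

Lemma monomial_eq0 a b : (p <= a)%N || (p <= b)%N -> monomial a b = 0.
Proof.
rewrite /monomial /pure => /orP[] /normal_basis_eq0->.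
  by rewrite tens0mx scaler0.
by rewrite tensmx0 scaler0.
Qed.

Lemma act_f1_monomial a b : act Gf1 *m monomial a b =
  monomial a.+1 b + (al * Q ^+ a) *: monomial a b.+1.
Proof.
rewrite /monomial /eval_tensor_act -scalemxAr mulmxDl !tensmx_pure mul1mx.
rewrite !Vf_normal_basis invVK_normal_basis -[nb b in X in X + _]scale1r.
rewrite !pureZ scalerDr !scalerA !qfactS mulr1.
by congr (_ *: _ + _ *: _); ring.
Qed.

Lemma act_e0_monomial a b : (q *: act Ge0) *m monomial a b =
  (be * Q ^+ b) *: monomial a.+1 b + y *: monomial a b.+1.
Proof.
rewrite /monomial /eval_tensor_act -scalemxAr -scalemxAl mulmxDl -!scalemxAl.
rewrite !tensmx_pure mul1mx !Vf_normal_basis invVK_normal_basis.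
rewrite -[nb a in X in _ + X]scale1r !pureZ !scalerDr !scalerA !qfactS mul1r.
by congr (_ *: _ + _ *: _); field; rewrite q_neq0.
Qed.

Lemma Q_neq0 : Q != 0.
Proof. by rewrite expf_neq0 ?q_neq0. Qed.

Lemma al_neq0 : al != 0.
Proof. exact: qpow_neq0. Qed.

Lemma word_monomial i j : act Ge0 ^+ i *m (act Gf1 ^+ j *m monomial 0 0) =
  q ^- i *: iter i (mulmx (q *: act Ge0))
                   (iter j (mulmx (act Gf1)) (monomial 0 0)).
Proof.
have -> : act Gf1 ^+ j *m monomial 0 0 =
    iter j (mulmx (act Gf1)) (monomial 0 0).
  elim: j => [|j IHj] /=; first by rewrite expr0 mul1mx.
  by rewrite exprS -IHj mulmxA.
elim: i => [|i IHi] /=; first by rewrite expr0 mul1mx invr1 scale1r.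
rewrite exprS -mulmxA IHi -scalemxAr -scalemxAl scalerA; congr (_ *: _).
by rewrite [q ^+ i.+1]exprS invfM mulrAC mulVf ?q_neq0 ?mul1r.
Qed.

Lemma pureE (i j : 'I_p) :
  pure (nb i) (nb j) = delta_mx (mxtens_index (i, j)) 0.
Proof.
apply/matrixP => k l; rewrite !ord1 /pure !mxE eqxx andbT.
case: (mxtens_indexP k) => a b; rewrite mxtens_indexK /= -natrM mulnb.
by rewrite (can_eq (@mxtens_indexK p p)) xpair_eqE.
Qed.

Lemma monomial_span (S : {vspace 'cV[R[i]]_(p * p)}) :
  (forall a b, monomial a b \in S) -> (fullv <= S)%VS.
Proof.
move=> S_mono; apply/subvP => v _; rewrite [v]matrix_sum_delta.
apply: memv_suml => k _; apply: memv_suml => l _; apply: memvZ.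
case: (mxtens_indexP k) => a b; rewrite ord1 -pureE.
have := S_mono a b; rewrite rpredZeq mulf_eq0.
by rewrite !(negbTE (qfact_neq0 (ltn_ord _))).
Qed.

(** Dual to the monomials of degree [d], with prescribed values [c a]. *)
Definition degree_functional d (c : nat -> R[i]) : 'rV[R[i]]_(p * p) :=
  \row_k let (a, b) := mxtens_unindex k in
    if (a + b == d)%N then c a / (qfact a * qfact b) else 0.

Lemma degree_functional_monomial d c a b : (d < p)%N ->
  \tr (degree_functional d c *m monomial a b) =
    if (a + b == d)%N then c a else 0.
Proof.
move=> lt_dp; have [h|] := boolP ((p <= a) || (p <= b))%N.
  by rewrite monomial_eq0 // mulmx0 mxtrace0 ifN //; lia.
rewrite negb_or -!ltnNge => /andP[lt_ap lt_bp].
rewrite /monomial (pureE (Ordinal lt_ap) (Ordinal lt_bp)) -scalemxAr -colE.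
rewrite mxtraceZ /mxtrace big_ord1 !mxE mxtens_indexK /=.
case: ifP => _; last by rewrite mulr0.
by rewrite mulrC divfK // mulf_neq0 ?qfact_neq0.
Qed.

Lemma resonance l : x != 0 -> (0 < l)%N ->
  (y / x == qpow logq (- (lambda1 + lambda2 - 2 * (l%:R - 1)))) =
  (y == al * be * Q ^+ l.-1).
Proof.
move=> x_neq0; case: l => // r _ /=.
have -> : - (lambda1 + lambda2 - 2 * (r.+1%:R - 1)) =
    - lambda1 - lambda2 + (2 * r)%:R.
  by rewrite -addn1 natrD natrM; ring.
rewrite !qpowD qpow_nat exprM eq_sym -(inj_eq (mulIf x_neq0)) divfK // eq_sym.
by congr (_ == _); ring.
Qed.

End EvaluationTensor.

Theorem theorem5p1 (R : realType) (p : nat) (q logq : R[i])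
    (lambda1 lambda2 x y : R[i])
    (p_odd : odd p) (p_ge3 : (3 <= p)%N)
    (q_order : p.-primitive_root q) (logq_log : expC logq = q)
    (x_neq0 : x != 0) (y_neq0 : y != 0)
    (lambda1_gen : forall i : nat, (i <= p)%N ->
       qnum logq (lambda1 + 1 - i%:R) != 0)
    (lambda2_gen : forall i : nat, (i <= p)%N ->
       qnum logq (lambda2 + 1 - i%:R) != 0)
    (lambda12_gen : forall i j : nat, (i <= p)%N -> (j <= p.-1)%N ->
       qnum logq (lambda1 + lambda2 - (2 * j)%:R + 1 - i%:R) != 0) :
  let act := eval_tensor_act logq p lambda1 lambda2 x y in
  basis_of fullv
    [seq act Ge0 ^+ i *m (act Gf1 ^+ j *m Omega0 logq p lambda1 lambda2)
       | i <- iota 0 p, j <- iota 0 p]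
  <-> (forall l : nat, (1 <= l <= p.-1)%N ->
         y / x != qpow logq (- (lambda1 + lambda2 - 2 * (l%:R - 1)))).
Proof.
move=> act; subst q.
have q0 := q_neq0 logq; have Q0 := Q_neq0 logq.
have Qprim := q2_prim p_odd q_order.
pose u := monomial logq p.
pose F : {linear 'cV[R[i]]_(p * p) -> 'cV[R[i]]_(p * p)} := mulmx (act Gf1).
pose E : {linear 'cV[R[i]]_(p * p) -> 'cV[R[i]]_(p * p)} :=
  mulmx (expC logq *: act Ge0).
have Fu := @act_f1_monomial R logq p lambda1 lambda2 x y.
have Eu := @act_e0_monomial R logq p lambda1 lambda2 x y.
pose g := qnum logq lambda2 / qnum logq (lambda1 + 1).
have g0 : g != 0.
  have := lambda1_gen 0%N isT; have := lambda2_gen 1%N (ltnW (ltnW p_ge3)).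
  by rewrite addrK subr0 => l2 l1; rewrite mulf_neq0 ?invr_neq0.
have wordE i j :
    act Ge0 ^+ i *m (act Gf1 ^+ j *m Omega0 logq p lambda1 lambda2) =
    (g * expC logq ^- i) *: iter i E (iter j F (u 0 0)).
  have -> : Omega0 logq p lambda1 lambda2 = g *: u 0 0.
    by rewrite /u /monomial /qfact !big_ord0 mulr1 scale1r.
  by rewrite -2!scalemxAr /act /u word_monomial scalerA.
have g_neq0 i : g * expC logq ^- i != 0.
  by rewrite mulf_neq0 ?invr_neq0 ?expf_neq0.
set X := flatten _; split=> [/andP[/eqP spanX _] l /andP[l_gt0 lt_lp]|y_gen].
  rewrite resonance //; apply/eqP => Dy.
  (* These values make phi the evaluation at - alpha in degree l; it takes the
     value 1 on v_0 (x) f^l w_0. *)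
  pose c a : R[i] :=
    (expC logq ^+ 2) ^+ 'C(a, 2) * (- qpow logq (- lambda1)) ^+ a.
  pose r := degree_functional logq p l c.
  pose phi : {scalar 'cV[R[i]]_(p * p)} := @mxtrace _ 1 \o mulmx r.
  have lt_l : (l < p)%N by lia.
  have phi_u a b : phi (u a b) = if (a + b == l)%N then c a else 0.
    exact: degree_functional_monomial.
  have phi_word i j : phi (iter i E (iter j F (u 0 0))) = 0.
    have lt_r : (l.-1 < l)%N by rewrite prednK.
    exact: (@functional_word_eq0 _ _ u F E _ _ _ _ Q0 Fu Eu phi
              l l.-1 i j phi_u lt_r Dy).
  have : phi (u 0%N l) = 0.
    have u_span : u 0%N l \in <<X>>%VS by rewrite spanX memvf.
    apply: span_scalar_eq0 u_span.
    move=> _ /allpairsP[[i j] [_ _ ->]].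
    by rewrite wordE linearZ phi_word /= mulr0.
  by move/eqP; rewrite phi_u add0n eqxx /c mul1r oner_eq0.
rewrite basisEdim; apply/andP; split; last first.
  by rewrite /X size_allpairs size_iota dimvf dim_matrix [leqRHS]muln1.
apply: (monomial_span p_odd p_ge3 q_order) => a b.
set S := span _ => /=.
have S_word i j : (i < p)%N -> (j < p)%N -> iter i E (iter j F (u 0 0)) \in S.
  move=> lt_i lt_j; have := allpairs_f (fun i j =>
      act Ge0 ^+ i *m (act Gf1 ^+ j *m Omega0 logq p lambda1 lambda2))
    (_ : i \in iota 0 p) (_ : j \in iota 0 p).
  rewrite !mem_iota lt_i lt_j => /(_ isT isT)/memv_span.
  by rewrite wordE rpredZeq (negbTE (g_neq0 i)).
apply: (word_span Q0 Fu Eu Qprim) => // [|i j|r lt_rp].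
- exact: al_neq0.
- exact: monomial_eq0.
- by have := y_gen r.+1; rewrite resonance //; apply; lia.
Qed.
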